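(* Let $\mathcal{A}$ be a unital $C^*$-algebra. Then $$\tilde{\mathcal{M}}\Phi_+^-(H_{\mathcal{A}}) = {\mathcal{M}\Phi_+^-}'(H_{\mathcal{A}}) \cap \mathcal{M}\Phi(H_{\mathcal{A}}), \qquad \tilde{\mathcal{M}}\Phi_-^+(H_{\mathcal{A}}) = {\mathcal{M}\Phi_-^+}'(H_{\mathcal{A}}) \cap \mathcal{M}\Phi(H_{\mathcal{A}}).$$
   Context: $\mathcal{A}$ is a unital $C^*$-algebra; $H_{\mathcal{A}} = \ell^2(\mathcal{A})$ is the standard Hilbert $\mathcal{A}$-module, and $B^a(H_{\mathcal{A}})$ is the $C^*$-algebra of bounded adjointable $\mathcal{A}$-linear operators on it. $M \tilde\oplus N$ denotes a direct sum of closed submodules that is not necessarily orthogonal. A Hilbert module is finitely generated if it is the (algebraic) $\mathcal{A}$-linear span of a finite set. An isomorphism of Hilbert modules is a bounded $\mathcal{A}$-linear bijection (with bounded inverse). $N \preceq N'$ means that $N$ is isomorphic to a closed submodule of $N'$. For $F \in B^a(H_{\mathcal{A}})$ consider closed submodules with $H_{\mathcal{A}} = M_1 \tilde\oplus N_1 = M_2 \tilde\oplus N_2$, $F(M_1) \subseteq M_2$, $F(N_1) \subseteq N_2$ and $F|_{M_1}: M_1 \to M_2$ an isomorphism; call this an admissible decomposition for $F$. Then: - $F \in \mathcal{M}\Phi(H_{\mathcal{A}})$ if there is an admissible decomposition with $N_1, N_2$ finitely generated; - $F \in \tilde{\mathcal{M}}\Phi_+^-(H_{\mathcal{A}})$ (resp.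 $\tilde{\mathcal{M}}\Phi_-^+(H_{\mathcal{A}})$) if there is an admissible decomposition with $N_1, N_2$ finitely generated and $N_1 \preceq N_2$ (resp. $N_2 \preceq N_1$); - $F \in {\mathcal{M}\Phi_+^-}'(H_{\mathcal{A}})$ if there is an admissible decomposition with $N_1$ finitely generated and $N_1 \preceq N_2$; - $F \in {\mathcal{M}\Phi_-^+}'(H_{\mathcal{A}})$ if there is an admissible decomposition with $N_2$ finitely generated and $N_2 \preceq N_1$. *)

(* Defs.v *)
From HB Require Import structures.
From mathcomp Require Import all_boot all_order all_algebra.
From mathcomp Require Import all_classical all_reals all_analysis.
From mathcomp Require Import complex.

Set Implicit Arguments.
Unset Strict Implicit.
Unset Printing Implicit Defensive.

Import Order.TTheory GRing.Theory Num.Theory.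
Import numFieldNormedType.Exports.

Local Open Scope classical_set_scope.
Local Open Scope ring_scope.

(* Unital C*-algebras, with scalars the complex numbers R[i].  As everywhere
   in the library, the norm of a normed module over R[i] is R[i]-valued; its
   values are nonnegative reals.  The multiplication is a field of the mixin
   because the hierarchy has no room for a join of the ring structures with the
   normed modules below the numeric domains.  The zero algebra is allowed. *)
HB.mixin Record isCStarAlgebra (R : realType) A
    of CompleteNormedModule R[i] A := {
  cmul : A -> A -> A;
  cone : A;
  star : A -> A;
  cmulA : associative cmul;
  cmul1x : left_id cone cmul;
  cmulx1 : right_id cone cmul;
  cmulDl : left_distributive cmul +%R;
  cmulDr : right_distributive cmul +%R;
  cmulZl : forall (c : R[i]) x y, cmul (c *: x) y = c *: cmul x y;
  cmulZr : forall (c : R[i]) x y, cmul x (c *: y) = c *: cmul x y;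
  starK : involutive star;
  starD : {morph star : x y / x + y};
  starZ : forall (c : R[i]) x, star (c *: x) = Num.conj c *: star x;
  starM : forall x y, star (cmul x y) = cmul (star y) (star x);
  norm_cmul : forall x y : A, `|cmul x y| <= `|x| * `|y|;
  norm_starM : forall x : A, `|cmul (star x) x| = `|x| ^+ 2
}.

#[short(type="cstarAlgType")]
HB.structure Definition CStarAlgebra (R : realType) :=
  {A of isCStarAlgebra R A & CompleteNormedModule R[i] A}.

Local Notation "x ** y" := (cmul x y) (at level 40, left associativity).

Section StandardModule.
Context {R : realType} (A : cstarAlgType R).

(* Vectors of l^2(A) and operators on it live in the ambient right A-module
   of all sequences; only membership in, and the behaviour on, the set
   [l2] are ever used. *)
Definition l2 : set (nat -> A) :=
  [set x | cvgn (series (fun k => star (x k) ** x k))].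

Definition inner (x y : nat -> A) : A :=
  limn (series (fun k => star (x k) ** y k)).

Definition l2norm (x : nat -> A) : R[i] := sqrtC `|inner x x|.

Definition ract (x : nat -> A) (a : A) : nat -> A := fun k => x k ** a.

Definition submodule (M : set (nat -> A)) : Prop :=
  [/\ M `<=` l2, M 0,
      forall x y, M x -> M y -> M (x + y)
    & forall x a, M x -> M (ract x a)].

Definition norm_closed (M : set (nat -> A)) : Prop :=
  forall x, l2 x ->
    (forall e : R[i], 0 < e -> exists2 y, M y & l2norm (x - y) < e) -> M x.

Definition closed_submodule (M : set (nat -> A)) : Prop :=
  submodule M /\ norm_closed M.

Definition fin_gen (M : set (nat -> A)) : Prop :=
  exists n (g : 'I_n -> nat -> A),
    M = [set \sum_(i < n) ract (g i) (a i) | a in [set: 'I_n -> A]].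

(* The not necessarily orthogonal direct sum decomposition of l^2(A). *)
Definition l2_dsum (M N : set (nat -> A)) : Prop :=
  [/\ closed_submodule M, closed_submodule N,
      [set x + y | x in M & y in N] = l2
    & M `&` N = [set 0]].

Definition alinear_on (M : set (nat -> A)) (T : (nat -> A) -> nat -> A) : Prop :=
  (forall x y, M x -> M y -> T (x + y) = T x + T y) /\
  (forall x a, M x -> T (ract x a) = ract (T x) a).

Definition bounded_op_on (M : set (nat -> A)) (T : (nat -> A) -> nat -> A) :
    Prop :=
  exists C : R[i], forall x, M x -> l2norm (T x) <= C * l2norm x.

Definition module_iso (M N : set (nat -> A)) (T : (nat -> A) -> nat -> A) :
    Prop :=
  [/\ alinear_on M T, bounded_op_on M T, set_bij M N T
    & exists2 S, bounded_op_on N S & forall x, M x -> S (T x) = x].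

Definition msubiso (N N' : set (nat -> A)) : Prop :=
  exists L, [/\ closed_submodule L, L `<=` N' & exists T, module_iso N L T].

(* B^a(H_A) *)
Definition adjointable : set ((nat -> A) -> nat -> A) :=
  [set F | [/\ set_fun l2 l2 F, alinear_on l2 F, bounded_op_on l2 F
     & exists2 G, set_fun l2 l2 G
         & forall x y, l2 x -> l2 y -> inner (F x) y = inner x (G y)]].

Definition admissible (F : (nat -> A) -> nat -> A)
    (M1 N1 M2 N2 : set (nat -> A)) : Prop :=
  [/\ l2_dsum M1 N1, l2_dsum M2 N2,
      set_fun M1 M2 F, set_fun N1 N2 F & module_iso M1 M2 F].

Definition MPhi : set ((nat -> A) -> nat -> A) :=
  [set F | adjointable F /\ exists M1 N1 M2 N2,
     [/\ admissible F M1 N1 M2 N2, fin_gen N1 & fin_gen N2]].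

(* The suffixes _pm and _mp stand for the decorations "_+^-" and "_-^+". *)
Definition MPhi_tilde_pm : set ((nat -> A) -> nat -> A) :=
  [set F | adjointable F /\ exists M1 N1 M2 N2,
     [/\ admissible F M1 N1 M2 N2, fin_gen N1, fin_gen N2 & msubiso N1 N2]].

Definition MPhi_tilde_mp : set ((nat -> A) -> nat -> A) :=
  [set F | adjointable F /\ exists M1 N1 M2 N2,
     [/\ admissible F M1 N1 M2 N2, fin_gen N1, fin_gen N2 & msubiso N2 N1]].

Definition MPhi_prime_pm : set ((nat -> A) -> nat -> A) :=
  [set F | adjointable F /\ exists M1 N1 M2 N2,
     [/\ admissible F M1 N1 M2 N2, fin_gen N1 & msubiso N1 N2]].

Definition MPhi_prime_mp : set ((nat -> A) -> nat -> A) :=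
  [set F | adjointable F /\ exists M1 N1 M2 N2,
     [/\ admissible F M1 N1 M2 N2, fin_gen N2 & msubiso N2 N1]].

End StandardModule.

Arguments l2 {R} A _.
Arguments adjointable {R} A _.
Arguments MPhi {R} A _.
Arguments MPhi_tilde_pm {R} A _.
Arguments MPhi_tilde_mp {R} A _.
Arguments MPhi_prime_pm {R} A _.
Arguments MPhi_prime_mp {R} A _.

(* Main.v *)
Require Import Defs.
From mathcomp Require Import all_boot all_order all_algebra.
From mathcomp Require Import all_classical all_reals all_analysis.

(** The classes on the left ask for one finiteness condition more than the
    primed classes: both complements [N1] and [N2] must be finitely generated.
    For an operator that has some admissible decomposition with finitely
    generated complements [N1'], [N2'], the missing condition is automatic, so
    that the very decomposition witnessing membership in the primed class
    witnesses membership in the smaller one.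

    The reason is algebraic.  A complement [N] of [M] is the image of any
    submodule [K] with [N] contained in [M + K] under the projection onto [N]
    along [M]; hence [N] is finitely generated as soon as [K] is
    ([fin_gen_complement]).

    - If [N1] is finitely generated: the range of [F] contains [M2'], so the
      whole space is [F M1 + F N1 + N2'], which is [M2 + (F N1 + N2')], and
      [K = F N1 + N2'] serves for [N2] ([fin_gen_target_complement]).

    - If [N2] is finitely generated: let [G] be the parametrix of [F] that
      inverts [F] on [M2'] and kills [N2'], so that [1 - G F] is the projection
      onto [N1'] along [M1'].  For [x] in [N1], both [x - G (F x)] is in [N1']
      and [G (F x)] is in [G N2], so [K = N1' + G N2] contains [N1]
      ([fin_gen_source_complement]). *)

Set Implicit Arguments.
Unset Strict Implicit.
Unset Printing Implicit Defensive.

Import GRing.Theory.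

Local Open Scope classical_set_scope.
Local Open Scope ring_scope.

Section FinitelyGeneratedComplements.
Context {R : realType} (A : cstarAlgType R).
Implicit Types (x y : nat -> A) (M N K L : set (nat -> A)).
Implicit Types (F G T : (nat -> A) -> nat -> A).

Definition msum M N : set (nat -> A) := [set x + y | x in M & y in N].

Lemma ractDl x y a : ract (x + y) a = ract x a + ract y a.
Proof. by apply/funext => k; rewrite /ract /= cmulDl. Qed.

Lemma ractx0 x : ract x 0 = 0.
Proof.
apply/funext => k; rewrite /ract.
by apply: (addrI (cmul (x k) 0)); rewrite -cmulDr !addr0.
Qed.

Lemma ractN1 x : ract x (- cone) = - x.
Proof.
apply/eqP; rewrite -subr_eq0 opprK; apply/eqP/funext => k.
have /(congr1 (fun f => f k)) := ractx0 x.
by rewrite /ract -(addNr cone) cmulDr cmulx1.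
Qed.

Lemma submoduleB M x y : submodule M -> M x -> M y -> M (x - y).
Proof. by move=> [_ _ MD Mr] Mx My; apply: MD => //; rewrite -ractN1; apply: Mr. Qed.

(** [l2] inherits closure under the module operations from the two summands,
    which spares any convergence argument. *)
Lemma dsum_submodule_l2 M N : l2_dsum M N -> submodule (l2 A).
Proof.
move=> [[[Ml M0 MD Mr] _] [[Nl N0 ND Nr] _] MN _]; split => //.
- exact: Ml.
- move=> x y; rewrite -MN => -[m Mm [n Nn <-]] [m' Mm' [n' Nn' <-]].
  by exists (m + m'); [exact: MD|exists (n + n'); [exact: ND|rewrite addrACA]].
- move=> x a; rewrite -MN => -[m Mm [n Nn <-]].
  by exists (ract m a); [exact: Mr|exists (ract n a); [exact: Nr|rewrite ractDl]].
Qed.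

Lemma l2_dsumC M N : l2_dsum M N -> l2_dsum N M.
Proof.
move=> [cM cN MN MN0]; split => //; last by rewrite setIC.
rewrite -MN; apply/seteqP; split => z [x Mx [y Ny <-]];
  by exists y => //; exists x => //; rewrite addrC.
Qed.

Lemma dsum_uniq M N m n m' n' : l2_dsum M N ->
  M m -> N n -> M m' -> N n' -> m + n = m' + n' -> n = n'.
Proof.
move=> [[sM _] [sN _] _ MN0] Mm Nn Mm' Nn' e.
have e' : n - n' = m' - m.
  by apply/eqP; rewrite subr_eq addrAC -e (addrC m) addrK.
have : (M `&` N) (n - n').
  by split; [rewrite e'|]; apply: submoduleB.
by rewrite MN0 => /= /eqP; rewrite subr_eq0 => /eqP.
Qed.

Lemma dsum_proj M N : l2_dsum M N -> exists P,
  [/\ alinear_on (l2 A) P, set_fun (l2 A) N P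
    & forall m n, M m -> N n -> P (m + n) = n].
Proof.
move=> MN; have [[[Ml M0 MD Mr] _] [[Nl N0 ND Nr] _] MNl _] := MN.
have /choice[P HP] x : exists n, l2 A x -> N n /\ exists2 m, M m & x = m + n.
  case: (pselect (l2 A x)) => [|nx]; last by exists 0.
  by rewrite -MNl => -[m Mm [n Nn <-]]; exists n => _; split=> //; exists m.
have PE m n : M m -> N n -> P (m + n) = n.
  move=> Mm Nn; have /HP[NP [m' Mm' e]] : l2 A (m + n).
    by rewrite -MNl; exists m => //; exists n.
  by apply/esym/(dsum_uniq MN Mm Nn Mm' NP e).
exists P; split=> //; last by move=> x /HP[].
split=> [x y|x a]; rewrite -!MNl.
- move=> [m Mm [n Nn <-]] [m' Mm' [n' Nn' <-]].
  by rewrite addrACA !PE //; [exact: MD|exact: ND].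
- move=> [m Mm [n Nn <-]]; rewrite ractDl !PE //; first exact: Mr.
  exact: Nr.
Qed.

Lemma fin_gen_msum K L : fin_gen K -> fin_gen L -> fin_gen (msum K L).
Proof.
move=> [p [g ->]] [q [h ->]]; exists (p + q)%N.
pose glue (V : Type) (u : 'I_p -> V) (v : 'I_q -> V) (i : 'I_(p + q)) :=
  match fintype.split i with inl j => u j | inr k => v k end.
have gluel V u v j : glue V u v (lshift q j) = u j.
  by rewrite /glue (unsplitK (inl j)).
have gluer V u v k : glue V u v (rshift p k) = v k.
  by rewrite /glue (unsplitK (inr k)).
exists (glue _ g h); apply/seteqP; split.
- move=> _ [_ [a _ <-] [_ [b _ <-] <-]]; exists (glue _ a b) => //.
  rewrite big_split_ord /=; congr (_ + _); apply: eq_bigr => i _.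
    by rewrite !gluel.
  by rewrite !gluer.
- move=> _ [a _ <-]; exists (\sum_(i < p) ract (g i) (a (lshift q i))).
    by exists (a \o lshift q).
  exists (\sum_(i < q) ract (h i) (a (rshift p i))).
    by exists (a \o @rshift p q).
  rewrite big_split_ord /=; congr (_ + _); apply: eq_bigr => i _.
    by rewrite gluel.
  by rewrite gluer.
Qed.

Lemma fin_gen_generator n (g : 'I_n -> nat -> A) i :
  [set \sum_(i < n) ract (g i) (a i) | a in [set: 'I_n -> A]] (g i).
Proof.
exists (fun j => if j == i then cone else 0) => //.
rewrite (bigD1 i) //= eqxx big1 ?addr0; last first.
  by move=> j /negbTE ->; rewrite ractx0.
by apply/funext => k; rewrite /ract cmulx1.
Qed.

Lemma alinear_sum M T n (u : 'I_n -> nat -> A) :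
  submodule M -> alinear_on M T -> (forall i, M (u i)) ->
  M (\sum_(i < n) u i) /\ T (\sum_(i < n) u i) = \sum_(i < n) T (u i).
Proof.
move=> [_ M0 MD Mr] [TD Tr] Mu.
elim/big_rec2: _ => [|i y1 y2 _ [My e]].
  by split=> //; rewrite -(ractx0 0) Tr // !ractx0.
by split; [exact: MD|rewrite TD // e].
Qed.

Lemma fin_gen_image M T K : submodule M -> alinear_on M T ->
  K `<=` M -> fin_gen K -> fin_gen (T @` K).
Proof.
move=> sM lT KM [n [g Kg]]; exists n, (T \o g).
have [_ _ _ Mr] := sM.
have TE (a : 'I_n -> A) : T (\sum_(i < n) ract (g i) (a i)) =
    \sum_(i < n) ract (T (g i)) (a i).
  have Mg i : M (g i) by apply: KM; rewrite Kg; exact: fin_gen_generator.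
  have [|_ ->] := alinear_sum (u := fun i => ract (g i) (a i)) sM lT.
    by move=> i; apply: Mr.
  by apply: eq_bigr => i _; rewrite lT.2.
rewrite Kg; apply/seteqP; split.
- by move=> _ [_ [a _ <-] <-]; exists a.
- by move=> _ [a _ <-]; exists (\sum_(i < n) ract (g i) (a i)); [exists a|].
Qed.

(** [N] is the image of [K] under the projection onto [N] along [M]. *)
Lemma fin_gen_complement M N K : l2_dsum M N -> K `<=` l2 A ->
  fin_gen K -> N `<=` msum M K -> fin_gen N.
Proof.
move=> MN Kl fK NMK; have sl := dsum_submodule_l2 MN.
have [P [lP PN PE]] := dsum_proj MN.
have [[[Ml M0 _ _] _] [[Nl N0 _ _] _] _ _] := MN.
suff -> : N = P @` K by exact: fin_gen_image sl lP Kl fK.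
apply/seteqP; split=> [n Nn|_ [k Kk <-]]; last exact: PN (Kl _ Kk).
have [m Mm [k Kk e]] := NMK _ Nn; exists k => //.
have Pm : P m = 0 by rewrite -[m]addr0 PE.
have Pn : P n = n by rewrite -[n in P n]add0r PE.
by rewrite -Pn -e lP.1 ?Pm ?add0r//; [exact: Ml|exact: Kl].
Qed.

Lemma fin_gen_target_complement F M1 N1 M2 N2 M1' N1' M2' N2' :
  alinear_on (l2 A) F ->
  admissible F M1 N1 M2 N2 -> admissible F M1' N1' M2' N2' ->
  fin_gen N1 -> fin_gen N2' -> fin_gen N2.
Proof.
move=> lF [d1 d2 FM FN _] [d1' d2' _ _ [_ _ [_ _ F_surj] _]] fN1 fN2'.
have sl := dsum_submodule_l2 d1.
have [[[M1l _ _ _] _] [[N1l _ _ _] _] E1 _] := d1.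
have [_ [[N2l _ _ _] _] _ _] := d2.
have [[[M1'l _ _ _] _] _ _ _] := d1'.
have [_ [[N2'l _ _ _] _] E2' _] := d2'.
apply: (fin_gen_complement (K := msum (F @` N1) N2') d2).
- move=> _ [_ [n Nn <-] [n' Nn' <-]]; case: sl => _ _ lD _.
  by apply: lD; [exact/N2l/FN|exact: N2'l].
- by apply: fin_gen_msum => //; exact: fin_gen_image sl lF N1l fN1.
move=> y /N2l; rewrite -E2' => -[m2' /F_surj[m1' Mm1' <-] [n2' Nn2' <-]].
move: (M1'l _ Mm1'); rewrite -E1 => -[m1 Mm1 [n1 Nn1 <-]].
exists (F m1); first exact: FM.
exists (F n1 + n2'); first by exists (F n1); [exists n1|exists n2'].
by rewrite addrA -lF.1 //; [exact: M1l|exact: N1l].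
Qed.

(** [G] is the projection onto [M2] along [N2] followed by the inverse of the
    isomorphism from [M1] to [M2]; since [F] maps [N1] into the kernel [N2] of
    that projection, [G F] is the projection onto [M1] along [N1]. *)
Lemma admissible_parametrix F M1 N1 M2 N2 : alinear_on (l2 A) F ->
  admissible F M1 N1 M2 N2 -> exists G,
  [/\ alinear_on (l2 A) G, set_fun (l2 A) M1 G
    & forall m n, M1 m -> N1 n -> G (F (m + n)) = m].
Proof.
move=> lF [d1 d2 FM FN [_ _ [_ _ F_surj] [S _ SF]]].
have [[[M1l _ M1D M1r] _] [[N1l _ _ _] _] _ _] := d1.
have [Q [lQ QM QE]] := dsum_proj (l2_dsumC d2).
exists (S \o Q); split.
  (* [S] is a mere left inverse of [F] on [M1]; it inherits linearity on [M2]
     from [F] because every element of [M2] is the image of one of [M1]. *)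
- split=> [x y lx ly|x a lx] /=; rewrite ?lQ.1 ?lQ.2//.
    have [u Mu <-] := F_surj _ (QM _ lx); have [v Mv <-] := F_surj _ (QM _ ly).
    by rewrite -lF.1 ?SF //; by [exact: M1D|exact: M1l].
  have [u Mu <-] := F_surj _ (QM _ lx).
  by rewrite -lF.2 ?SF //; by [exact: M1r|exact: M1l].
- by move=> x /QM /F_surj[u Mu] /= <-; rewrite SF.
- move=> m n Mm Nn /=; rewrite lF.1 //; try by [exact: M1l|exact: N1l].
  by rewrite addrC QE ?SF //; [exact: FN|exact: FM].
Qed.

Lemma fin_gen_source_complement F M1 N1 M2 N2 M1' N1' M2' N2' :
  alinear_on (l2 A) F ->
  admissible F M1 N1 M2 N2 -> admissible F M1' N1' M2' N2' ->
  fin_gen N2 -> fin_gen N1' -> fin_gen N1.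
Proof.
move=> lF [d1 d2 _ FN _] adm' fN2 fN1'.
have [d1' _ _ _ _] := adm'.
have [G [lG GM GE]] := admissible_parametrix lF adm'.
have sl := dsum_submodule_l2 d1.
have [[[_ M10 _ _] _] [[N1l _ _ _] _] _ _] := d1.
have [_ [[N2l _ _ _] _] _ _] := d2.
have [[[M1'l _ _ _] _] [[N1'l _ _ _] _] E1' _] := d1'.
apply: (fin_gen_complement (K := msum N1' (G @` N2)) d1).
- move=> _ [n' Nn' [_ [n Nn <-] <-]]; case: sl => _ _ lD _.
  by apply: lD; [exact: N1'l|exact/M1'l/GM/N2l].
- by apply: fin_gen_msum => //; exact: fin_gen_image sl lG N2l fN2.
move=> x Nx; exists 0 => //; exists x; last by rewrite add0r.
move: (N1l _ Nx); rewrite -E1' => -[m Mm [n Nn e]].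
exists n => //; exists m; last by rewrite addrC.
by exists (F x); [exact: FN|rewrite -e GE].
Qed.

End FinitelyGeneratedComplements.

Local Close Scope ring_scope.

Theorem proposition5p7 (R : realType) (A : cstarAlgType R) :
  MPhi_tilde_pm A = MPhi_prime_pm A `&` MPhi A /\
  MPhi_tilde_mp A = MPhi_prime_mp A `&` MPhi A.
Proof.
split; apply/seteqP; split => F.
- move=> [adjF [M1 [N1 [M2 [N2 [adm f1 f2 sub]]]]]].
  by split; split=> //; exists M1, N1, M2, N2.
- move=> [[adjF [M1 [N1 [M2 [N2 [adm f1 sub]]]]]]].
  move=> [_ [M1' [N1' [M2' [N2' [adm' _ f2']]]]]].
  have [_ lF _ _] := adjF.
  split=> //; exists M1, N1, M2, N2; split=> //.
  exact: (fin_gen_target_complement lF adm adm').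
- move=> [adjF [M1 [N1 [M2 [N2 [adm f1 f2 sub]]]]]].
  by split; split=> //; exists M1, N1, M2, N2.
- move=> [[adjF [M1 [N1 [M2 [N2 [adm f2 sub]]]]]]].
  move=> [_ [M1' [N1' [M2' [N2' [adm' f1' _]]]]]].
  have [_ lF _ _] := adjF.
  split=> //; exists M1, N1, M2, N2; split=> //.
  exact: (fin_gen_source_complement lF adm adm').
Qed.
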